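(* Let $\{M(t)\}_{t\ge0}$ be the generalized counting process with rates $\lambda_1,\dots,\lambda_k>0$, $\Lambda=\lambda_1+\cdots+\lambda_k$, let $\{H(t)\}_{t\ge0}$ be an independent multistable subordinator with stability index $\beta(t)\in(0,1)$, and let $X(t)=M(H(t))$. For an integer $m\ge1$ let $T_{m}=\inf\{s\ge0:X(s)\ge m\}$ be the time of the first upcrossing of the level $m$. Then, for $t\ge0$, $$\Pr\{T_{m}>t\}=\sum_{n=0}^{m-1}\sum_{\Omega(k,n)}\left(\prod_{j=1}^{k}\frac{(-\lambda_{j})^{x_{j}}}{x_{j}!}\right)\frac{\mathrm{d}^{z_{k}}}{\mathrm{d}\Lambda^{z_{k}}}e^{-\int_{0}^{t}\Lambda^{\beta(\tau)}\mathrm{d}\tau},$$ where $z_k=x_1+\cdots+x_k$.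
   Context: Generalized counting process (GCP): the (càdlàg) Lévy process $\{M(t)\}_{t\ge0}$ with values in the non-negative integers, $M(0)=0$, and $\Pr\{M(t)=n\}=\sum_{\Omega(k,n)}\prod_{j=1}^{k}\frac{(\lambda_{j}t)^{x_{j}}}{x_{j}!}e^{-\Lambda t}$, where $\Omega(k,n)=\{(x_1,\dots,x_k): x_j\in\{0,1,2,\dots\},\ \sum_{j=1}^k jx_j=n\}$. A multistable subordinator $\{H(t)\}_{t\ge0}$ with stability index $\beta(t)\in(0,1)$ ($t\mapsto\beta(t)$ a regular function) is a non-decreasing (càdlàg) process with $H(0)=0$ and independent increments such that $\mathbb{E}(e^{-u(H(t)-H(s))})=e^{-\int_s^tu^{\beta(\tau)}\,\mathrm{d}\tau}$ for $0\le s\le t$, $u>0$. The derivative $\frac{\mathrm{d}^{z}}{\mathrm{d}\Lambda^{z}}$ is the ordinary derivative of the one-variable function $\Lambda\mapsto e^{-\int_0^t\Lambda^{\beta(\tau)}\mathrm{d}\tau}$, with the $\lambda_j$ in the product held fixed, evaluated at $\Lambda=\lambda_1+\cdots+\lambda_k$. *)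

(* Defs.v *)
From HB Require Import structures.
From mathcomp Require Export all_boot all_order all_algebra.
From mathcomp Require Export all_classical all_reals all_analysis.
Export Order.TTheory GRing.Theory Num.Theory.
Export numFieldNormedType.Exports.

Set Implicit Arguments.
Unset Strict Implicit.
Unset Printing Implicit Defensive.

Local Open Scope classical_set_scope.
Local Open Scope ring_scope.

(* Processes are families indexed by all of R; only the times t >= 0 matter,
   and every condition below is restricted to such times. *)

Definition cadlag (R : realType) (f : R -> R) : Prop :=
  (forall t, 0 <= t -> f s @[s --> t^'+] --> f t) /\
  (forall t, 0 < t -> cvg (f s @[s --> t^'-])).

Section processes.
Context {d : measure_display} {T : measurableType d} {R : realType}.
Variable P : probability T R.

(* Since the B i may be taken to be setT, the product rule over the whole family
   contains the product rule over every subfamily. *)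
Definition mutually_independent (n : nat) (Y : 'I_n -> T -> R) : Prop :=
  forall B : 'I_n -> set R, (forall i, measurable (B i)) ->
  P (\bigcap_(i in [set: 'I_n]) (Y i @^-1` B i)) =
  (\prod_(i < n) P (Y i @^-1` B i))%E.

Definition independent_increments (X : R -> T -> R) : Prop :=
  forall (n : nat) (ts : nat -> R), 0 <= ts 0%N ->
  (forall i, (i < n)%N -> ts i <= ts i.+1) ->
  mutually_independent (fun (i : 'I_n) w => X (ts i.+1) w - X (ts i) w).

Definition stationary_increments (X : R -> T -> R) : Prop :=
  forall s h : R, 0 <= s -> 0 <= h -> forall B : set R, measurable B ->
  P [set w | B (X (s + h) w - X s w)] = P [set w | B (X h w - X 0 w)].

Definition stochastically_continuous (X : R -> T -> R) : Prop :=
  forall t eps : R, 0 <= t -> 0 < eps ->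
  P [set w | eps < `|X s w - X t w|]
    @[s --> within [set s | 0 <= s] (nbhs t)] --> 0%E.

Record levy_process (X : R -> T -> R) : Prop := LevyProcess {
  levy_init : forall w, X 0 w = 0 ;
  levy_cadlag : forall w, cadlag (fun t => X t w) ;
  levy_independent : independent_increments X ;
  levy_stationary : stationary_increments X ;
  levy_continuous : stochastically_continuous X }.

(* The index j : 'I_k stands for j.+1 in {1, ..., k}.  The constraint
   \sum_j j x_j = n forces x_j <= n, so bounding the x_j by n loses no solution
   and makes the set finite. *)
Definition Omega (k n : nat) : {set {ffun 'I_k -> 'I_n.+1}} :=
  [set x : {ffun 'I_k -> 'I_n.+1} | (\sum_(j < k) j.+1 * x j == n)%N].

Record generalized_counting_process (k : nat) (lambda : 'I_k -> R)
    (M : R -> {RV P >-> nat}) : Prop := GeneralizedCountingProcess {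
  gcp_levy : levy_process (fun t w => (M t w)%:R) ;
  gcp_law : forall (t : R) (n : nat), 0 <= t ->
    P [set w | M t w = n] =
    (\sum_(x in Omega k n)
       (\prod_(j < k) ((lambda j * t) ^+ x j / (x j)`!%:R)) *
       expR (- (\sum_(j < k) lambda j) * t))%:E }.

Definition multistable_exponent (beta : R -> R) (s t u : R) : R :=
  \int[lebesgue_measure]_(tau in `[s, t]) (u `^ beta tau).

Record multistable_subordinator (beta : R -> R)
    (H : R -> {RV P >-> R}) : Prop := MultistableSubordinator {
  ms_init : forall w, H 0 w = 0 ;
  ms_nondecreasing : forall w s t, 0 <= s -> s <= t -> H s w <= H t w ;
  ms_cadlag : forall w, cadlag (fun t => H t w) ;
  ms_independent : independent_increments (fun t => H t) ;
  ms_laplace : forall s t u : R, 0 <= s -> s <= t -> 0 < u ->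
    'E_P[fun w => expR (- u * (H t w - H s w))%R]%E =
    (expR (- multistable_exponent beta s t u))%:E }.

Definition process_sigma (d' : measure_display) (S : measurableType d')
    (X : R -> T -> S) : set (set T) :=
  <<s [set A | exists t B, [/\ 0 <= t, measurable B & A = X t @^-1` B] ] >>.

Definition independent_processes (d1 d2 : measure_display)
    (S1 : measurableType d1) (S2 : measurableType d2)
    (X : R -> T -> S1) (Y : R -> T -> S2) : Prop :=
  forall A B, process_sigma X A -> process_sigma Y B ->
  P (A `&` B) = (P A * P B)%E.

(* Infimum in the extended reals: it is +oo if the level is never reached. *)
Definition upcrossing_time (X : R -> T -> nat) (m : nat) (w : T) : \bar R :=
  ereal_inf [set s%:E | s in [set s : R | 0 <= s /\ (m <= X s w)%N]].

End processes.

(* Main.v *)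
Require Import Defs.
From mathcomp Require Import ring lra zify measurable_realfun.

(** The paths of X(s) = M(H(s)) are right continuous, because H is nondecreasing
    and right continuous and M is right continuous, and almost surely
    nondecreasing, because M has stationary increments and nonnegative values.
    Hence {T_m > t} and {X(t) < m} differ by a null event
    (prob_lt_upcrossing_time), and the probability sought is the sum over n < m
    of P(X(t) = n).

    Since H(t) is independent of M, P(X(t) = n) is the expectation of p_n(H(t)),
    where p_n(s) = P(M(s) = n) (prob_random_time). To see this, approximate H(t)
    from the right by random times with values in (1/(N+1))Z: for these the formula
    is a countable sum over products of independent events, and right continuity of
    the paths allows the passage to the limit.

    Finally p_n(s) is a sum over Omega(k,n) of the weights
    prod_j (-lambda_j)^(x_j)/(x_j)! times (-s)^z exp(-Lambda s), with z the sum of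
    the x_j. Differentiation under the expectation identifies
    E((-H(t))^z exp(-u H(t))) with the z-th derivative in u of E(exp(-u H(t)))
    (derive1n_laplace); near Lambda > 0 the latter function is
    exp(-int_0^t u^beta), so the z-th derivatives at Lambda agree
    (derive1n_eq_pos). *)

Set Implicit Arguments.
Unset Strict Implicit.
Unset Printing Implicit Defensive.

Local Open Scope classical_set_scope.
Local Open Scope ring_scope.

(** * Approximation of a time from the right *)

(** The least multiple of 1/(N+1) strictly above y. Strictness is what makes the
    grid approach y from the right, the only side on which a cadlag path is
    continuous. *)
Definition grid {R : realType} (N : nat) (y : R) : R :=
  (Num.truncn (N.+1%:R * y)).+1%:R / N.+1%:R.

Lemma grid_ge0 (R : realType) N (y : R) : 0 <= grid N y.
Proof. by rewrite /grid divr_ge0. Qed.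

Lemma lt_grid (R : realType) N (y : R) : y < grid N y.
Proof. by rewrite /grid ltr_pdivlMr// mulrC truncnS_gt. Qed.

Lemma grid_le (R : realType) N (y : R) : 0 <= y -> grid N y <= y + N.+1%:R^-1.
Proof.
move=> y0; rewrite /grid ler_pdivrMr// mulrDl mulVf// -natr1 lerD2r.
by rewrite [leRHS]mulrC truncn_le mulr_ge0.
Qed.

Lemma grid_at_right (R : realType) (y : R) : 0 <= y ->
  grid N y @[N --> \oo] --> y^'+.
Proof.
move=> y0 A; rewrite /at_right /= /within /= => yA.
have cvg_grid : grid N y @[N --> \oo] --> y.
  apply: (@squeeze_cvgr _ _ _ _ (cst y) (fun N : nat => y + N.+1%:R^-1)).
  - by apply: nearW => N /=; rewrite ltW ?lt_grid// grid_le.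
  - exact: cvg_cst.
  - rewrite -[X in _ --> X]addr0; apply: cvgD; first exact: cvg_cst.
    exact: cvg_harmonic.
move: (cvg_grid _ yA); rewrite /= /nbhs /=; apply: filterS => N /=.
by move=> /(_ (lt_grid N y)).
Qed.

(** Distinct natural numbers are at distance at least 1. *)
Lemma right_continuous_nat (R : realType) (f : R -> nat) (a : R) :
  ((f s)%:R : R) @[s --> a^'+] --> ((f a)%:R : R) ->
  \forall s \near a^'+, f s = f a.
Proof.
move=> /cvgrPdist_lt /(_ 1 ltr01); apply: filterS => s.
have [le_fas|/ltnW le_fsa] := leqP (f a) (f s).
  rewrite distrC -natrB// ger0_norm// (ltr_nat _ _ 1); lia.
rewrite -natrB// ger0_norm// (ltr_nat _ _ 1); lia.
Qed.

(** * Processes observed at a random time *)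

Lemma measurable_preim d d' (T : measurableType d) (U : measurableType d')
    (f : T -> U) (C : set U) :
  measurable_fun setT f -> measurable C -> measurable (f @^-1` C).
Proof. by move=> mf mC; rewrite -[X in measurable X]setTI; exact: mf. Qed.

Lemma measurable_truncn (R : realType) :
  measurable_fun [set: R] (Num.truncn : R -> nat).
Proof.
have mle n : measurable [set x : R | (Num.truncn x <= n)%N].
  rewrite (_ : [set x | _] = [set` `]-oo, n.+1%:R[ ]).
    exact: measurable_itv.
  by apply/seteqP; split => x /=; rewrite truncn_le_nat in_itv.
move=> _ B _; rewrite setTI.
rewrite (_ : _ @^-1` B = \bigcup_(n in B) [set x : R | Num.truncn x = n]);
  last by apply/seteqP; split => [x Bx|x [n Bn /= ->]//]; exists (Num.truncn x).
apply: bigcup_measurable => -[|n] _.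
  rewrite [X in measurable X](_ : _ = [set x : R | (Num.truncn x <= 0)%N]) //.
  by apply/seteqP; split => x /=; lia.
rewrite [X in measurable X](_ : _ =
  [set x : R | (Num.truncn x <= n.+1)%N] `\`
  [set x : R | (Num.truncn x <= n)%N]).
  exact: measurableD.
by apply/seteqP; split => x /=; lia.
Qed.

(** A preimage splits into countably many pieces, one for each value of J. *)
Lemma measurable_fun_switch d d' (T : measurableType d) (U : measurableType d')
    (J : T -> nat) (g : nat -> T -> U) :
  measurable_fun setT J -> (forall n, measurable_fun setT (g n)) ->
  measurable_fun setT (fun w => g (J w) w).
Proof.
move=> mJ mg _ B mB; rewrite setTI.
rewrite (_ : _ @^-1` B = \bigcup_n (J @^-1` [set n] `&` g n @^-1` B));
  last first.
  by apply/seteqP; split => [w Bw|w [n _ [/= -> //]]]; exists (J w).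
apply: bigcupT_measurable => n; apply: measurableI.
- exact: measurable_preim.
- exact: measurable_preim.
Qed.

Section random_time.
Context d (T : measurableType d) (R : realType).
Variables (Z : R -> T -> nat) (Y : T -> R).
Hypothesis mZ : forall s, 0 <= s -> measurable_fun setT (Z s).
Hypothesis rcZ : forall w s, 0 <= s -> \forall r \near s^'+, Z r w = Z s w.
Hypothesis mY : measurable_fun setT Y.
Hypothesis Y0 : forall w, 0 <= Y w.

Let cell N w := Num.truncn (N.+1%:R * Y w).

Let mcell N : measurable_fun setT (cell N).
Proof.
apply: (measurableT_comp (@measurable_truncn R)).
by apply: measurable_funM => //; exact: measurable_cst.
Qed.

Lemma measurable_grid N : measurable_fun setT (fun w => Z (grid N (Y w)) w).
Proof.
apply: (@measurable_fun_switch _ _ _ _ (cell N)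
  (fun j w => Z (j.+1%:R / N.+1%:R) w)) => // n.
by apply: mZ; rewrite divr_ge0.
Qed.

Lemma near_grid_eq w : \forall N \near \oo, Z (grid N (Y w)) w = Z (Y w) w.
Proof. exact: (grid_at_right (Y0 w) (rcZ w (Y0 w))). Qed.

(** Z (Y w) w is the eventual value of Z (grid N (Y w)) w, where the random time
    takes countably many values. The limit is taken among real functions, through
    the embedding of nat in R, which truncation inverts. *)
Lemma measurable_random_time : measurable_fun setT (fun w => Z (Y w) w).
Proof.
have mR : measurable_fun setT (fun w => (Z (Y w) w)%:R : R).
  apply: (@measurable_fun_cvg _ _ _ _
      (fun N w => (Z (grid N (Y w)) w)%:R)) => [N|w _].
    apply: (@measurableT_comp _ _ _ _ _ _ (fun n : nat => n%:R : R)) => //.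
    exact: measurable_grid.
  by apply: cvg_near_cst; apply: filterS (near_grid_eq w) => N ->.
rewrite (_ : (fun w => _) = Num.truncn \o (fun w => (Z (Y w) w)%:R : R)).
  exact: (measurableT_comp (@measurable_truncn R)).
by apply/funext => w /=; rewrite natrK.
Qed.

End random_time.

Section random_time_law.
Context d (T : measurableType d) (R : realType) (P : probability T R).
Variables (Z : R -> T -> nat) (B : set nat).
Hypothesis mZ : forall s, 0 <= s -> measurable_fun setT (Z s).
Hypothesis rcZ : forall w s, 0 <= s -> \forall r \near s^'+, Z r w = Z s w.

(** The indicators of the events converge pointwise, being eventually constant;
    dominated convergence does the rest. For constant Y this is right
    continuity, along the grid, of the law of Z s in s. *)
Lemma cvg_prob_grid (Y : T -> R) :
  measurable_fun setT Y -> (forall w, 0 <= Y w) ->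
  P [set w | B (Z (grid N (Y w)) w)] @[N --> \oo] --> P [set w | B (Z (Y w) w)].
Proof.
move=> mY Y0.
have mX := measurable_random_time mZ rcZ mY Y0.
have mXN := measurable_grid mZ mY.
have mB : measurable B by [].
have PE (A : set T) : measurable A -> P A = (\int[P]_w (\1_A w)%:E)%E.
  by move=> mA; rewrite integral_indic// setIT.
rewrite PE; last exact: (measurable_preim mX).
rewrite (_ : (fun N => _) = (fun N =>
    \int[P]_w (\1_[set w | B (Z (grid N (Y w)) w)] w)%:E)%E); last first.
  by apply/funext => N; rewrite PE//; exact: (measurable_preim (mXN N)).
apply: (@dominated_cvg _ _ _ _ _ _ _ _ (cst 1%E)) => //.
- move=> N; apply/measurable_EFinP/measurable_indic.
  exact: (measurable_preim (mXN N)).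
- move=> w _; apply: cvg_near_cst.
  apply: filterS (near_grid_eq rcZ Y0 w) => N /= eN; rewrite !indicE.
  by congr ((nat_of_bool _)%:R%:E); apply/idP/idP; rewrite !inE /= eN.
- exact: finite_measure_integrable_cst.
- move=> N w _ /=; rewrite lee_fin indicE.
  by case: (_ \in _); rewrite ?normr1 ?normr0.
Qed.

(** Conditioning on an independent random time: P(Z_Y in B) = E(F(Y)) with
    F(s) = P(Z_s in B). With grid N (Y) in place of Y, independence gives the
    formula cell by cell, since the random time is constant on each cell; both
    sides then pass to the limit by cvg_prob_grid, the right-hand one applied at
    the deterministic time Y w. *)
Lemma prob_random_time (Y : T -> R) :
  measurable_fun setT Y -> (forall w, 0 <= Y w) ->
  (forall s C, 0 <= s -> measurable C ->
     P ((Z s @^-1` B) `&` (Y @^-1` C)) = (P (Z s @^-1` B) * P (Y @^-1` C))%E) ->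
  P [set w | B (Z (Y w) w)] = (\int[P]_w P (Z (Y w) @^-1` B))%E.
Proof.
move=> mY Y0 indep.
have mB : measurable B by [].
have mF N : measurable_fun setT (fun w => P (Z (grid N (Y w)) @^-1` B)).
  apply: (@measurable_fun_switch _ _ _ _ (fun w => Num.truncn (N.+1%:R * Y w))
    (fun j w => P (Z (j.+1%:R / N.+1%:R) @^-1` B))) => //.
  apply: (measurableT_comp (@measurable_truncn R)).
  by apply: measurable_funM => //; exact: measurable_cst.
have grid_eq N : P [set w | B (Z (grid N (Y w)) w)] =
    (\int[P]_w P (Z (grid N (Y w)) @^-1` B))%E.
  pose tr y := Num.truncn (N.+1%:R * y : R).
  pose D j := Y @^-1` (tr @^-1` [set j]).
  have mS j : measurable (tr @^-1` [set j]).
    apply: measurable_preim => //.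
    apply: (measurableT_comp (@measurable_truncn R)).
    by apply: measurable_funM => //; exact: measurable_cst.
  have mD j : measurable (D j) by exact: measurable_preim.
  have DT : setT = \bigcup_j D j.
    by apply/seteqP; split => // w _; exists (Num.truncn (N.+1%:R * Y w)).
  have tD : trivIset setT D.
    by move=> i j _ _ [w [/= <- <-]].
  have mE : measurable [set w | B (Z (grid N (Y w)) w)].
    exact: (measurable_preim (measurable_grid mZ mY N)).
  rewrite -[X in P X]setIT -integral_indic// DT !ge0_integral_bigcup//;
    last 2 first.
  - by rewrite -DT.
  - by rewrite -DT; apply/measurable_EFinP/measurable_indic.
  apply: eq_eseriesr => j _; rewrite integral_indic//.
  have gridD w : D j w -> grid N (Y w) = j.+1%:R / N.+1%:R 
    by rewrite /D/= /tr /grid => ->.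
  (* on the j-th cell the random time is frozen *)
  rewrite (_ : _ `&` D j = (Z (j.+1%:R / N.+1%:R) @^-1` B) `&` D j); last first.
    by apply/seteqP; split => w [/= + Dw]; rewrite (gridD _ Dw).
  rewrite [LHS](indep _ (tr @^-1` [set j]))// ?divr_ge0//.
  rewrite -integral_cst; last exact: mD.
  by apply: eq_integral => w /[!inE] Dw; rewrite (gridD _ Dw).
have Fy w : P (Z (grid N (Y w)) @^-1` B) @[N --> \oo] --> P (Z (Y w) @^-1` B).
  by apply: (@cvg_prob_grid (cst (Y w))) => // ?; exact: Y0.
apply: (cvg_unique (@ereal_hausdorff R) (cvg_prob_grid mY Y0)).
rewrite (funext grid_eq).
apply: (@dominated_cvg _ _ _ _ _ _ _ _ (cst 1%E)) => //.
- exact: finite_measure_integrable_cst.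
- move=> N w _; rewrite gee0_abs//; apply: probability_le1.
  by apply: measurable_preim => //; apply: mZ; exact: grid_ge0.
Qed.

End random_time_law.

(** * Derivatives of a Laplace transform *)

(** Half of the exponential absorbs one factor x, because (c/2) x <= exp((c/2) x);
    the other half is left for the remaining n factors. *)
Lemma exprn_expR_bounded (R : realType) n (c : R) : 0 < c ->
  exists2 K, 0 <= K & forall x, 0 <= x -> x ^+ n * expR (- c * x) <= K.
Proof.
elim: n c => [|n IH] c c0.
  exists 1 => // x x0; rewrite expr0 mul1r -[leRHS]expR0 ler_expR.
  by rewrite mulNr oppr_le0 mulr_ge0// ltW.
have c2 : 0 < c / 2 by rewrite divr_gt0.
have [K K0 HK] := IH _ c2.
exists ((c / 2)^-1 * K) => [|x x0]; first by rewrite mulr_ge0// invr_ge0 ltW.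
have -> : x ^+ n.+1 * expR (- c * x) =
    (x * expR (- (c / 2) * x)) * (x ^+ n * expR (- (c / 2) * x)).
  rewrite exprS mulrACA -expRD; congr (_ * expR _); by field.
apply: ler_pM => //; rewrite ?mulr_ge0 ?exprn_ge0 ?expR_ge0 ?HK//.
rewrite -(ler_pM2l c2) mulfV ?gt_eqF// mulrA -ler_pdivlMr ?expR_gt0//.
rewrite mulNr expRN div1r invrK; apply: le_trans (expR_ge1Dx _).
by rewrite lerDr.
Qed.

(** The Laplace exponent is known for positive arguments only; higher derivatives
    there depend on nothing else since the half-line is open. *)
Lemma derive1n_eq_pos (R : realType) (f g : R -> R) n :
  (forall u, 0 < u -> f u = g u) ->
  forall u, 0 < u -> derive1n n f u = derive1n n g u.
Proof.
move=> fg; elim: n => // n IH u u0.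
rewrite !derive1nS !derive1E; apply: near_eq_derive.
by near=> x; apply: IH; near: x; exact: lt_nbhsr.
Unshelve. all: by end_near. Qed.

Section laplace.
Context d (T : measurableType d) (R : realType) (P : probability T R).
Variable Y : T -> R.
Hypothesis mY : measurable_fun setT Y.
Hypothesis Y0 : forall w, 0 <= Y w.

Let f n u w := (- Y w) ^+ n * expR (- u * Y w).

Let mf n u : measurable_fun setT (f n u).
Proof.
apply: measurable_funM.
  by apply: measurable_funX; exact: measurableT_comp.
apply: measurableT_comp => //.
by apply: measurable_funM => //; exact: measurable_cst.
Qed.

(** A bound uniform in u >= a, as domination under the integral sign requires. *)
Let f_bounded n a : 0 < a ->
  exists2 K, 0 <= K & forall u w, a <= u -> `|f n u w| <= K.
Proof.
move=> a0; have [K K0 HK] := exprn_expR_bounded n a0.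
exists K => // u w au; rewrite normrM normrX normrN (ger0_norm (Y0 w)).
rewrite (ger0_norm (expR_ge0 _)); apply: le_trans (HK _ (Y0 w)).
by rewrite ler_wpM2l ?exprn_ge0// ler_expR ler_wpM2r// lerN2.
Qed.

Lemma integrable_laplace n u : 0 < u -> P.-integrable setT (EFin \o f n u).
Proof.
move=> u0; have [K K0 HK] := f_bounded n u0.
apply: measurable_bounded_integrable => //.
  by rewrite (le_lt_trans (probability_le1 P measurableT))// ltry.
exists K; split=> [|x Kx w _ /=]; first exact: num_real.
by apply: le_trans (HK _ _ _) _ => //; exact: ltW.
Qed.

Let is_derive_f n w (u : R) : is_derive u 1 (f n ^~ w) (f n.+1 u w).
Proof.
rewrite /f; apply: is_derive_eq.
rewrite /GRing.scale/= exprS; ring.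
Qed.

Lemma derive_laplace n u : 0 < u ->
  derive1 (fun v => \int[P]_w f n v w) u = \int[P]_w f n.+1 u w.
Proof.
move=> u0.
have u2 : 0 < u / 2 by rewrite divr_gt0.
have [K K0 HK] := f_bounded n.+1 u2.
have d1f v w : partial1of2 (f n) v w = f n.+1 v w.
  by rewrite partial1of2E; apply: derive_val.
(* any interval around u that stays away from 0 would do *)
rewrite (@differentiation_under_integral R d T P (f n) setT measurableT u
  (u / 2) (u * 2) _ _ _ (cst K)).
- by apply: eq_Rintegral => w _; exact: d1f.
- by rewrite /= in_itv/=; lra.
- move=> v; rewrite /= in_itv/= => /andP[/(lt_trans u2) + _].
  exact: integrable_laplace.
- by move=> v w _ _; exact: ex_derive.
- by [].
- exact: finite_measure_integrable_cst.
- by move=> v w; rewrite /= in_itv/= d1f => /andP[/ltW + _] _; exact: HK.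
Qed.

Lemma derive1n_laplace n u : 0 < u ->
  derive1n n (fun v => \int[P]_w expR (- v * Y w)) u =
  \int[P]_w ((- Y w) ^+ n * expR (- u * Y w)).
Proof.
move=> u0; rewrite (_ : (fun v => _) = (fun v => \int[P]_w f 0 v w));
  last first.
  by apply/funext => v; apply: eq_Rintegral => w _; rewrite /f mul1r.
elim: n u u0 => // n IH u u0.
rewrite derive1nS -derive_laplace// !derive1E; apply: near_eq_derive.
by near=> x; apply: IH; near: x; exact: lt_nbhsr.
Unshelve. all: by end_near. Qed.

End laplace.

(** * Right-continuous integer-valued paths *)

Lemma near_at_right_itv (R : realType) (x : R -> nat) (s : R) :
  (\forall r \near s^'+, x r = x s) ->
  exists2 e, 0 < e & forall r, s <= r < s + e -> x r = x s.
Proof.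
case=> e /= e0 He; exists e => // r /andP[].
rewrite le_eqVlt => /predU1P[->//|sr re].
apply: He => //=; rewrite distrC ger0_norm; last by rewrite subr_ge0 ltW.
by rewrite ltrBlDl.
Qed.

(** A nondecreasing h approaches h s from the right, so right continuity of x
    at h s is enough. *)
Lemma right_constant_comp (R : realType) (x : R -> nat) (h : R -> R) (s : R) :
  (forall r, s <= r -> h s <= h r) -> h r @[r --> s^'+] --> h s ->
  (\forall y \near (h s)^'+, x y = x (h s)) ->
  \forall r \near s^'+, x (h r) = x (h s).
Proof.
move=> h_ge ch /near_at_right_itv[e e0 He].
have hlt : \forall r \near s^'+, h r < h s + e.
  by apply: (cvgr_lt (h s) ch); rewrite ltrDl.
near=> r; apply: He; apply/andP; split; last by near: r.
by apply: h_ge; apply: ltW; near: r; exact: nbhs_right_gt.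
Unshelve. all: by end_near. Qed.

(** Right constancy at t rules out the one way in which the infimum could equal t
    without the level being reached by time t: hitting times decreasing to t. *)
Lemma lt_upcrossing_timeP d (T : measurableType d) (R : realType)
    (X : R -> T -> nat) (m : nat) (w : T) (t : R) : 0 <= t ->
  (\forall r \near t^'+, X r w = X t w) ->
  (t%:E < upcrossing_time X m w)%E <->
  (forall s, 0 <= s <= t -> (X s w < m)%N).
Proof.
move=> t0 rcX; split=> [tT s /andP[s0 st]|Xm].
  rewrite ltnNge; apply/negP => ms; move: tT; apply/negP; rewrite -leNgt.
  by apply: ge_ereal_inf; exists s%:E; [exists s|rewrite lee_fin].
have [e e0 He] := near_at_right_itv rcX.
apply: (@lt_le_trans _ _ (t + e)%:E); first by rewrite lte_fin ltrDl.
apply: le_ereal_inf_tmp => _ [s [s0 ms] <-]; rewrite lee_fin leNgt.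
apply/negP => ste; move: ms; apply/negP; rewrite -ltnNge.
have [st|ts] := leP s t; first by apply: Xm; rewrite s0.
by rewrite He ?ste ?ltW//; apply: Xm; rewrite t0 lexx.
Qed.

(** Turns an uncountable family of constraints into a countable one, so that the
    corresponding event is measurable. *)
Lemma lt_on_rationals (R : realType) (x : R -> nat) (m : nat) (t : R) : 0 <= t ->
  (forall s, 0 <= s -> \forall r \near s^'+, x r = x s) ->
  (forall s, 0 <= s <= t -> (x s < m)%N) <->
  (x t < m)%N /\ forall q : rat, 0 <= (ratr q : R) < t -> (x (ratr q) < m)%N.
Proof.
move=> t0 rcx; split=> [xm|[xtm xm] s /andP[s0]].
  by split=> [|q /andP[q0 /ltW qt]]; apply: xm; rewrite ?t0 ?lexx ?q0.
rewrite le_eqVlt => /predU1P[->//|st].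
have [e e0 He] := near_at_right_itv (rcx _ s0).
have : s < Num.min t (s + e) by rewrite lt_min st ltrDl.
move/rat_in_itvoo => [q]; rewrite in_itv/= lt_min => /and3P[sq qt qe].
rewrite -(He (ratr q)); first by apply: xm; rewrite qt (le_trans s0)// ltW.
by rewrite qe ltW.
Qed.

(** Exhibits an arbitrary descent of the path inside a countable union of events
    at fixed times, each of which can be shown to be null. *)
Lemma decrease_on_rationals (R : realType) (x : R -> nat) (a b : R) :
  0 <= a -> a <= b ->
  (forall s, 0 <= s -> \forall r \near s^'+, x r = x s) -> (x b < x a)%N ->
  exists p q : rat, [/\ 0 <= ratr p :> R, ratr p <= ratr q :> R &
                       (x (ratr q) < x (ratr p))%N].
Proof.
move=> a0 ab rcx xba.
have b0 : 0 <= b by exact: le_trans ab.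
have {ab}ab : a < b.
  by rewrite lt_neqAle ab andbT; apply/eqP => eab; move: xba; rewrite eab ltnn.
have [e e0 He] := near_at_right_itv (rcx _ a0).
have [f f0 Hf] := near_at_right_itv (rcx _ b0).
have : a < Num.min b (a + e) by rewrite lt_min ab ltrDl.
move/rat_in_itvoo => [p]; rewrite in_itv/= lt_min => /and3P[ap pb pe].
have : b < b + f by rewrite ltrDl.
move/rat_in_itvoo => [q]; rewrite in_itv/= => /andP[bq qf].
exists p, q; split; [by rewrite (le_trans a0)// ltW| |].
  by apply: ltW; exact: lt_trans bq.
by rewrite (He (ratr p)) ?(Hf (ratr q)) ?pe ?qf ?ltW.
Qed.

Lemma negligible_bigcup_countable d (T : measurableType d) (R : realType)
    (mu : {measure set T -> \bar R}) (I : countType) (F : I -> set T) :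
  (forall i, mu.-negligible (F i)) -> mu.-negligible (\bigcup_i F i).
Proof.
move=> F0; pose G n := if unpickle n is Some i then F i else set0.
have FG : \bigcup_i F i `<=` \bigcup_n G n.
  by move=> w [i _ Fi]; exists (pickle i); rewrite // /G pickleK.
apply: (negligibleS FG).
apply: negligible_bigcup => n; rewrite /G.
by case: unpickle => //; exact: negligible_set0.
Qed.

Section levy_nat.
Context d (T : measurableType d) (R : realType) (P : probability T R).
Variable M : R -> {RV P >-> nat}.
Hypothesis hM : levy_process P (fun t w => (M t w)%:R : R).

(** By stationarity the increment over [p, q] has the law of M (q - p), which is
    nonnegative. *)
Lemma prob_decrease (p q : R) : 0 <= p -> p <= q ->
  P [set w | (M q w < M p w)%N] = 0%E.
Proof.
move=> p0 pq.
have := levy_stationary hM p0 (_ : 0 <= q - p)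
  (measurable_itv `]-oo, (0 : R)[).
rewrite subr_ge0 => /(_ pq); rewrite subrKC.
rewrite [X in P X = _ -> _](_ : _ = [set w | (M q w < M p w)%N]);
  last first.
  by apply/seteqP; split => w /=; rewrite in_itv/= subr_lt0 ltr_nat.
move=> ->; rewrite [X in P X](_ : _ = set0) ?measure0//.
apply/seteqP; split => // w /=; rewrite in_itv/= (levy_init hM) subr0.
by rewrite ltrn0.
Qed.

Lemma negligible_decrease :
  P.-negligible [set w | exists p q : rat,
    [/\ 0 <= ratr p :> R, ratr p <= ratr q :> R &
        (M (ratr q) w < M (ratr p) w)%N]].
Proof.
rewrite (_ : [set w | _] = \bigcup_(pq : rat * rat)
    [set w | [/\ 0 <= ratr pq.1 :> R, ratr pq.1 <= ratr pq.2 :> R &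
              (M (ratr pq.2) w < M (ratr pq.1) w)%N]]); last first.
  apply/seteqP; split => [w [p [q pq]]|w [[p q] _ pq]]; first by exists (p, q).
  by exists p, q.
apply: negligible_bigcup_countable => -[p q] /=.
have [p0|/negP p0] := boolP (0 <= ratr p :> R); last first.
  by apply: (negligibleS _ (negligible_set0 P)) => w [].
have [pq|/negP pq] := boolP (ratr p <= ratr q :> R); last first.
  by apply: (negligibleS _ (negligible_set0 P)) => w [].
exists [set w | (M (ratr q) w < M (ratr p) w)%N]; split.
- rewrite (_ : [set w | _] =
    (fun w => (M (ratr q) w < M (ratr p) w)%N) @^-1` [set true]) //.
  apply: measurable_preim => //.
  exact: measurable_fun_ltn.
- exact: prob_decrease.
- by move=> w [].
Qed.

End levy_nat.

(** * The counting process at the time of the subordinator *)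

(** The two signs cancel; (- y) ^+ z * expR (- c * y) is the z-th derivative of
    c |-> expR (- c * y), which is why they are introduced. *)
Lemma gcp_weightE (R : realType) k n (lambda : 'I_k -> R)
    (x : {ffun 'I_k -> 'I_n.+1}) (c y : R) :
  (\prod_(j < k) ((lambda j * y) ^+ x j / (x j)`!%:R)) * expR (- c * y) =
  (\prod_(j < k) ((- lambda j) ^+ x j / (x j)`!%:R)) *
    ((- y) ^+ (\sum_(j < k) x j) * expR (- c * y)).
Proof.
rewrite mulrA; congr (_ * _); rewrite -prodrXr -big_split/=.
apply: eq_bigr => j _; rewrite mulrAC -exprMn.
by rewrite mulrNN.
Qed.

Section time_changed.
Context d (T : measurableType d) (R : realType) (P : probability T R).
Variables (k : nat) (lambda : 'I_k -> R).
Hypothesis hk : (0 < k)%N.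
Hypothesis hlambda : forall j, 0 < lambda j.
Variable beta : R -> R.
Variable M : R -> {RV P >-> nat}.
Hypothesis hM : generalized_counting_process lambda M.
Variable H : R -> {RV P >-> R}.
Hypothesis hH : multistable_subordinator beta H.
Hypothesis hMH : independent_processes P (fun t => M t) (fun t => H t).

Let Lambda := \sum_(j < k) lambda j.

Lemma total_rate_gt0 : 0 < Lambda.
Proof.
rewrite /Lambda; case: k hk lambda hlambda => // k' _ l l0.
by rewrite big_ord_recl ltr_pwDl// sumr_ge0// => i _; exact: ltW.
Qed.

Lemma subordinator_ge0 t w : 0 <= t -> 0 <= H t w.
Proof. by move=> t0; rewrite -(ms_init hH w); exact: (ms_nondecreasing hH). Qed.

Lemma gcp_right_constant w s : 0 <= s -> \forall r \near s^'+, M r w = M s w.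
Proof.
move=> s0; apply: (@right_continuous_nat R (M ^~ w)).
by have [+ _] := levy_cadlag (gcp_levy hM) w; exact.
Qed.

Lemma time_changed_right_constant w s : 0 <= s ->
  \forall r \near s^'+, M (H r w) w = M (H s w) w.
Proof.
move=> s0; apply: (@right_constant_comp R (M ^~ w) (H ^~ w)).
- by move=> r sr; exact: (ms_nondecreasing hH).
- by have [+ _] := ms_cadlag hH w; exact.
- by apply: gcp_right_constant; exact: subordinator_ge0.
Qed.

Lemma measurable_time_changed s : 0 <= s ->
  measurable_fun setT (fun w => M (H s w) w).
Proof.
move=> s0; apply: (@measurable_random_time _ _ _ (fun t w => M t w)) => //.
- exact: gcp_right_constant.
- by move=> w; exact: subordinator_ge0.
Qed.

Lemma laplace_subordinator t u : 0 <= t -> 0 < u ->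
  \int[P]_w expR (- u * H t w) = expR (- multistable_exponent beta 0 t u).
Proof.
move=> t0 u0; have := ms_laplace hH (lexx 0) t0 u0.
rewrite unlock => /(congr1 fine)/= <-.
by congr fine; apply: eq_integral => w _; rewrite (ms_init hH) subr0.
Qed.

(** Conditioning on H t gives the expectation of the counting law at time H t,
    a combination of the moments E((- H t)^z exp(- Lambda * H t)), and these are
    the derivatives of the Laplace transform of H t at Lambda. *)
Lemma prob_time_changed_eq t n : 0 <= t ->
  P [set w | M (H t w) w = n] =
  (\sum_(x in Omega k n)
     (\prod_(j < k) ((- lambda j) ^+ x j / (x j)`!%:R)) *
     derive1n (\sum_(j < k) x j)
       (fun u : R => expR (- multistable_exponent beta 0 t u)) Lambda)%:E.
Proof.
move=> t0; have Ht0 w : 0 <= H t w by exact: subordinator_ge0.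
rewrite (@prob_random_time _ _ _ P (fun t w => M t w) [set n] _ _ (H t))//;
  first last.
- move=> s C s0 mC; apply: hMH; apply: sub_sigma_algebra.
  + by exists s, [set n].
  + by exists t, C.
- exact: gcp_right_constant.
pose g (x : {ffun 'I_k -> 'I_n.+1}) w :=
  (\prod_(j < k) ((- lambda j) ^+ x j / (x j)`!%:R)) *
    ((- H t w) ^+ (\sum_(j < k) x j) * expR (- Lambda * H t w)).
rewrite (eq_integral (fun w => \sum_(x in Omega k n) (g x w)%:E)%E); last first.
  move=> w _; rewrite (gcp_law hM _ (Ht0 w)) sumEFin; congr EFin.
  by apply: eq_bigr => x _; exact: gcp_weightE.
have iH z := integrable_laplace P (measurable_funPT (H t)) Ht0 z total_rate_gt0.
rewrite integral_sum//; last first.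
  move=> x; rewrite /g; under eq_fun do rewrite EFinM.
  by apply: integrableZl => //; exact: iH.
rewrite -sumEFin; apply: eq_bigr => x _; rewrite /g.
under eq_integral do rewrite EFinM.
rewrite integralZl//; last exact: iH.
rewrite EFinM; congr (_ * _)%E.
rewrite -(@derive1n_eq_pos _ (fun v => \int[P]_w expR (- v * H t w)));
  last 2 first.
- by move=> u u0; exact: laplace_subordinator.
- exact: total_rate_gt0.
rewrite (derive1n_laplace P (measurable_funPT (H t)) Ht0) ?total_rate_gt0//.
rewrite /Rintegral fineK//.
exact: (integrable_fin_num measurableT (iH _)).
Qed.

Lemma prob_time_changed_lt t m : 0 <= t ->
  P [set w | (M (H t w) w < m)%N] =
  (\sum_(0 <= n < m) P [set w | M (H t w) w = n])%E.
Proof.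
move=> t0; have mX B : measurable ((fun w => M (H t w) w) @^-1` B).
  by apply: measurable_preim => //; exact: measurable_time_changed.
elim: m => [|m IH].
  rewrite big_geq// (_ : [set _ | _] = set0) ?measure0//.
  by apply/seteqP; split.
rewrite big_nat_recr//= -IH -measureU.
- congr (P _); apply/seteqP; split => w /=.
    by rewrite ltnS leq_eqVlt => /predU1P[]; tauto.
  by case=> [/ltnW//|->]; exact: ltnSn.
- exact: (mX [set n | (n < m)%N]).
- exact: (mX [set m]).
- by apply/seteqP; split => // w [/= + e]; rewrite e ltnn.
Qed.

(** The paths of the time-changed process are monotone only almost surely, so the
    two events need not be equal. The first is contained in the second, and on the
    difference M decreases between H s and H t for some s <= t, a null event.
    Measurability of the first event is proved separately, from its description by
    rational times, for the space is not assumed complete. *)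
Lemma prob_lt_upcrossing_time t m : 0 <= t ->
  P [set w | (t%:E < upcrossing_time (fun s w => M (H s w) w) m w)%E] =
  P [set w | (M (H t w) w < m)%N].
Proof.
move=> t0; set X := fun s w => M (H s w) w.
have mX s : 0 <= s -> measurable [set w | (X s w < m)%N].
  move=> s0; apply: (@measurable_preim _ _ _ _ (X s) [set n | (n < m)%N]) => //.
  exact: measurable_time_changed.
set E := [set w | _]; set A := [set w | (_ < m)%N].
have rcX w s : 0 <= s -> \forall r \near s^'+, X r w = X s w.
  exact: time_changed_right_constant.
have EE w : E w <-> forall s, 0 <= s <= t -> (X s w < m)%N.
  by apply: lt_upcrossing_timeP => //; exact: rcX.
have mE : measurable E.
  have -> : E = A `&` ~` \bigcup_(q in [set q : rat | 0 <= (ratr q : R) < t])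
      ~` [set w | (X (ratr q) w < m)%N].
    apply/seteqP; split => w.
      move/EE/(lt_on_rationals m t0 (rcX w)) => [Aw Qw]; split=> // -[q q0t].
      by apply; exact: Qw.
    move=> [Aw Qw]; apply/EE/(lt_on_rationals m t0 (rcX w)); split=> // q q0t.
    by apply: contrapT => nX; apply: Qw; exists q.
  apply: measurableI; first exact: mX.
  apply: measurableC; rewrite bigcup_mkcond; apply: bigcupT_measurable_rat => q.
  case: ifPn => [|_]; last exact: measurable0.
  by rewrite inE/= => /andP[q0 _]; apply: measurableC; exact: mX.
have mA : measurable A by exact: mX.
have AE0 : P (A `\` E) = 0%E.
  apply/negligibleP; first exact: measurableD.
  apply: (negligibleS _ (negligible_decrease (gcp_levy hM))) => w [Aw /EE nE].
  have [s s0t mXs] : exists2 s, 0 <= s <= t & (m <= X s w)%N.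
    apply: contrapT => nex; apply: nE => s s0t; rewrite ltnNge.
    by apply/negP => mXs; apply: nex; exists s.
  have /andP[s0 st] := s0t.
  apply: (@decrease_on_rationals R (M ^~ w) (H s w) (H t w)).
  - exact: subordinator_ge0.
  - exact: (ms_nondecreasing hH).
  - by move=> r r0; exact: gcp_right_constant.
  - exact: leq_trans mXs.
have -> : P A = (P (A `\` E) + P (A `&` E))%E by exact: measureDI.
rewrite AE0 add0e; congr (P _).
apply/seteqP; split => [w Ew|w []//]; split => //.
by apply: (EE w).1; rewrite ?t0 ?lexx.
Qed.

End time_changed.

Theorem proposition4p1 (d : measure_display) (T : measurableType d)
  (R : realType) (P : probability T R)
  (k : nat) (hk : (0 < k)%N)
  (lambda : 'I_k -> R) (hlambda : forall j, 0 < lambda j)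
  (beta : R -> R) (hbeta : forall t, 0 <= t -> 0 < beta t < 1)
  (mbeta : measurable_fun [set t : R | 0 <= t] beta)
  (M : R -> {RV P >-> nat}) (hM : generalized_counting_process lambda M)
  (H : R -> {RV P >-> R}) (hH : multistable_subordinator beta H)
  (hMH : independent_processes P (fun t => M t) (fun t => H t))
  (m : nat) (hm : (1 <= m)%N) (t : R) (ht : 0 <= t) :
  let X : R -> T -> nat := fun s w => M (H s w) w in
  let Lambda : R := \sum_(j < k) lambda j in
  P [set w | (t%:E < upcrossing_time X m w)%E] =
  (\sum_(0 <= n < m) \sum_(x in Omega k n)
     (\prod_(j < k) ((- lambda j) ^+ x j / (x j)`!%:R)) *
     derive1n (\sum_(j < k) x j)
       (fun u : R => expR (- multistable_exponent beta 0 t u)) Lambda)%:E.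
Proof.
move=> X Lambda.
rewrite (prob_lt_upcrossing_time hM hH)// (prob_time_changed_lt hM hH)// -sumEFin.
by apply: eq_bigr => n _; exact: (prob_time_changed_eq hk hlambda hM hH hMH).
Qed.
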